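(* For a junction with incoming roads $1,\ldots,n$ and outgoing roads $n+1,\ldots,n+m$, write $H_{i,j}(t):=H\big(u_{hi}^-(b_i,t),u_{hj}^+(a_j,t),\alpha_{j,i}\big)$ and consider the $\alpha$-inside Godunov junction fluxes $$H_j(t)=\sum_{i=1}^{n}H_{i,j}(t)\ (j=n+1,\ldots,n+m),\qquad H_i(t)=\sum_{j=n+1}^{n+m}H_{i,j}(t)\ (i=1,\ldots,n).$$ Then for all $j=n+1,\ldots,n+m$, $$H_j(t)=\sum_{i=1}^n\alpha_{j,i}H_i(t)+E_j(t),$$ where $$E_j(t)=\sum_{i=1}^n\sum_{\substack{l=n+1\\ l\ne j}}^{n+m}\big(\alpha_{l,i}H_{i,j}(t)-\alpha_{j,i}H_{i,l}(t)\big).$$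
   Context: Junction: $n,m\ge 1$; each road $k\in\{1,\ldots,n+m\}$ is an interval $[a_k,b_k]$; roads $1,\ldots,n$ are incoming (the junction is at their right endpoint $b_i$) and roads $n+1,\ldots,n+m$ are outgoing (the junction is at their left endpoint $a_j$). The traffic distribution coefficients $\alpha_{j,i}$ ($i=1,\ldots,n$, $j=n+1,\ldots,n+m$) satisfy $0\le\alpha_{j,i}\le1$ and $\sum_{j=n+1}^{n+m}\alpha_{j,i}=1$ for every $i$. Discrete densities: $\mathcal{T}_{hk}$ is a finite partition of $[a_k,b_k]$ into closed intervals with disjoint interiors, $S_{hk}$ is the space of functions on $[a_k,b_k]$ that are polynomials of degree at most $p$ on each element $K\in\mathcal{T}_{hk}$ (possibly discontinuous between elements), and $u_{hk}\in C^1([0,T];S_{hk})$ is the discrete (DG) density on road $k$. One-sided traces are $v^-(x)=\lim_{y\to x-}v(y)$ and $v^+(x)=\lim_{y\to x+}v(y)$. Time $t\in[0,T]$. Flux: $f\in C^1(\mathbb{R})$ has a global maximum at $u_*$, is non-decreasing on $(-\infty,u_*]$ and non-increasing on $[u_*,\infty)$. The Godunov numerical flux with three variables is $H(u^-,u^+,\alpha)=\min\{\alpha f_{in}(u^-),f_{out}(u^+)\}$, where $f_{in}(u^-)=f(u^-)$ if $u^-<u_*$ and $f_{in}(u^-)=f(u_* )$ if $u^-\ge u_*$; $f_{out}(u^+)=f(u_* )$ if $u^+\le u_*$ and $f_{out}(u^+)=f(u^+)$ if $u^+>u_*$. *)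

(* Defs.v *)
From HB Require Import structures.
From mathcomp Require Export all_boot all_order all_algebra.
From mathcomp Require Export all_classical all_reals all_analysis.
Set Implicit Arguments.
Unset Strict Implicit.
Unset Printing Implicit Defensive.
Import Order.TTheory GRing.Theory Num.Theory.
Import numFieldNormedType.Exports.
Local Open Scope classical_set_scope.
Local Open Scope ring_scope.

(* The set Th of elements K is a finite partition of [a, b] into nondegenerate
   closed intervals with pairwise disjoint interiors. *)
Definition is_mesh (R : realType) (a b : R) (Th : set (set R)) : Prop :=
  [/\ finite_set Th,
      forall K, Th K -> exists l r : R, l < r /\ K = `[l, r]%classic,
      \bigcup_(K in Th) K = `[a, b]%classic
    & trivIset Th (fun K => K°)].

(* Piecewise polynomials of degree at most p.  The elements share endpoints, at
   which a discontinuous function has no preferred value, so the polynomial is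
   prescribed on the interior of each element only. *)
Definition broken_poly (R : realType) (Th : set (set R)) (p : nat)
    (v : R -> R) : Prop :=
  forall K, Th K ->
    exists q : {poly R}, (size q <= p.+1)%N /\ forall x, K° x -> v x = q.[x].

(* u, with u t x the value at time t and position x, is in C^1([0, T]; S_h),
   where S_h is the finite-dimensional space of broken polynomials, with the
   sup norm over the interiors of the elements.  The time derivative du is
   one-sided at 0 and T. *)
Definition C1_broken_poly (R : realType) (Th : set (set R)) (p : nat) (T : R)
    (u : R -> R -> R) : Prop :=
  let D := \bigcup_(K in Th) K° in
  (forall t, t \in `[0, T] -> broken_poly Th p (u t)) /\
  exists du : R -> R -> R, forall t, t \in `[0, T] ->
    [/\ broken_poly Th p (du t),
        {uniform D, (fun s x => (s - t)^-1 * (u s x - u t x))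
                      @ within `[0, T]%classic t^' --> du t}
      & {uniform D, du @ within `[0, T]%classic (nbhs t) --> du t}].

Definition trace_left (R : realType) (v : R -> R) (x : R) : R :=
  lim (v y @[y --> x^'-]).

Definition trace_right (R : realType) (v : R -> R) (x : R) : R :=
  lim (v y @[y --> x^'+]).

Definition unimodal_flux (R : realType) (f : R -> R) (ustar : R) : Prop :=
  [/\ (forall x, derivable f x 1) /\ continuous (derive1 f),
      forall x, f x <= f ustar,
      forall x y, x <= y -> y <= ustar -> f x <= f y
    & forall x y, ustar <= x -> x <= y -> f y <= f x].

Definition f_in (R : realType) (f : R -> R) (ustar u : R) : R :=
  if u < ustar then f u else f ustar.

Definition f_out (R : realType) (f : R -> R) (ustar u : R) : R :=
  if u <= ustar then f ustar else f u.

Definition godunov (R : realType) (f : R -> R) (ustar um up alpha : R) : R :=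
  Num.min (alpha * f_in f ustar um) (f_out f ustar up).

(* Roads are indexed by 'I_(n + m): the incoming ones are lshift m i with
   i : 'I_n, the outgoing ones rshift n j with j : 'I_m.  The coefficient of
   the traffic going from i to j is alpha j i. *)
Definition traffic_distribution (R : realType) (n m : nat)
    (alpha : 'I_m -> 'I_n -> R) : Prop :=
  (forall j i, 0 <= alpha j i <= 1) /\ (forall i, \sum_(j < m) alpha j i = 1).

Definition junction_flux (R : realType) (n m : nat) (f : R -> R) (ustar : R)
    (a b : 'I_(n + m) -> R) (alpha : 'I_m -> 'I_n -> R)
    (u : 'I_(n + m) -> R -> R -> R) (t : R) (i : 'I_n) (j : 'I_m) : R :=
  godunov f ustar (trace_left (u (lshift m i) t) (b (lshift m i)))
                  (trace_right (u (rshift n j) t) (a (rshift n j)))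
                  (alpha j i).

Definition flux_out (R : realType) (n m : nat) (H : 'I_n -> 'I_m -> R)
    (j : 'I_m) : R := \sum_(i < n) H i j.

Definition flux_in (R : realType) (n m : nat) (H : 'I_n -> 'I_m -> R)
    (i : 'I_n) : R := \sum_(j < m) H i j.

Definition distribution_error (R : realType) (n m : nat)
    (alpha : 'I_m -> 'I_n -> R) (H : 'I_n -> 'I_m -> R) (j : 'I_m) : R :=
  \sum_(i < n) \sum_(l < m | l != j) (alpha l i * H i j - alpha j i * H i l).

(* Main.v *)
Require Import Defs.
Import Order.TTheory GRing.Theory Num.Theory.
Import numFieldNormedType.Exports.
Local Open Scope classical_set_scope.
Local Open Scope ring_scope.

(* The special form of the junction fluxes plays no role: the identity is
   H i j = (\sum_l alpha l i) * H i j, with the term l = j split off. *)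
Lemma flux_out_decomposition (R : realType) (n m : nat)
    (alpha : 'I_m -> 'I_n -> R) (H : 'I_n -> 'I_m -> R) (j : 'I_m) :
  (forall i, \sum_(l < m) alpha l i = 1) ->
  flux_out H j =
    \sum_(i < n) alpha j i * flux_in H i + distribution_error alpha H j.
Proof.
move=> alpha1; rewrite /flux_out /distribution_error -big_split /=.
(* The identity already holds for each incoming road [i] separately. *)
apply: eq_bigr => i _; have := alpha1 i.
(* With S and Q the sums of [alpha l i] and of [H i l] over [l != j], [sum1] reads
   [alpha j i + S = 1] and the goal [H i j = alpha j i * (H i j + Q) + (S * H i j - alpha j i *
   Q)]. *)
rewrite (bigD1 j) //= /flux_in (bigD1 (F := H i) j) //= sumrB -mulr_suml -mulr_sumr => sum1.
(* Only the [H i j] on the left is multiplied by [1 = alpha j i + S]; on the right the two terms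
   [alpha j i * Q] cancel. *)
by rewrite -{1}[H i j]mul1r -sum1 mulrDl mulrDr addrACA subrr addr0.
Qed.

Theorem lemma15 (R : realType) (n m : nat) (hn : (1 <= n)%N) (hm : (1 <= m)%N)
    (a b : 'I_(n + m) -> R) (hab : forall k, a k < b k)
    (alpha : 'I_m -> 'I_n -> R) (halpha : traffic_distribution alpha)
    (Th : 'I_(n + m) -> set (set R))
    (hTh : forall k, is_mesh (a k) (b k) (Th k))
    (p : nat) (T : R) (u : 'I_(n + m) -> R -> R -> R)
    (hu : forall k, C1_broken_poly (Th k) p T (u k))
    (f : R -> R) (ustar : R) (hf : unimodal_flux f ustar)
    (t : R) (ht : t \in `[0, T]) :
  let H := junction_flux f ustar a b alpha u t in
  forall j : 'I_m,
    flux_out H j =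
      \sum_(i < n) alpha j i * flux_in H i + distribution_error alpha H j.
Proof. by move=> H j; exact: flux_out_decomposition (proj2 halpha). Qed.
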